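(* Let $\Phi$ be a reduced finite root system with simple roots $\alpha_1,\dots,\alpha_r$ and Cartan matrix $A=(a_{ij})$, $a_{ij}=\langle\alpha_i,\alpha_j^\vee\rangle$. Let $F=\sum_{\beta}N_\beta\Phi_\beta$ be a BPS resummed potential supported on $\Phi$ (the sum being over positive roots), take the difference directions to be the simple coroots $\eta_i=\alpha_i^\vee$, and let $\mathbf H=(\nabla_{\eta_i}\nabla_{\eta_j}F)_{1\le i,j\le r}$. Put $u=e^{i\lambda/2}$, $$\mathbf c_j(u)=([a_{j1}]_u,\dots,[a_{jr}]_u)^T,\qquad A_u=([a_{ji}]_u)_{j,i},$$ $$D_N=\operatorname{diag}(N_{\alpha_1},\dots,N_{\alpha_r}),\qquad \mathcal G(u)=-\sum_{j=1}^r[q^{\alpha_j}]\mathbf H .$$ Then for every simple root $\alpha_j$, $$-[q^{\alpha_j}]\mathbf H=N_{\alpha_j}\,\mathbf c_j(u)\,\mathbf c_j(u)^T .$$ If $N_{\alpha_j}\ne0$ for all simple roots, these Laurent polynomial profiles determine the complete signed Cartan matrix through $$\frac{\bigl(-[q^{\alpha_j}]\mathbf H\bigr)_{ij}}{\bigl(-[q^{\alpha_j}]\mathbf H\bigr)_{jj}}=\frac{[a_{ji}]_u}{[2]_u},$$ and, at $u=1$, $$a_{ji}=2\,\frac{\bigl(-[q^{\alpha_j}]\mathbf H^{\rm cl}\bigr)_{ij}}{\bigl(-[q^{\alpha_j}]\mathbf H^{\rm cl}\bigr)_{jj}}\qquad(1\le i,j\le r).$$ Moreover, $$\mathcal G(u)=A_u^TD_NA_u,\qquad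 \det\mathcal G(u)=\Bigl(\prod_{j}N_{\alpha_j}\Bigr)\det(A_u)^2 .$$
   Context: $\Lambda=\bigoplus_j\mathbb Z\alpha_j$ is the root lattice with effective monoid $\Lambda_+=\bigoplus_j\mathbb Z_{\ge0}\alpha_j$, $\Lambda^\vee=\operatorname{Hom}(\Lambda,\mathbb Z)$, and simple coroots are regarded as elements of $\Lambda^\vee$. All series in the Novikov variables $q^\beta=e^{2\pi i\langle\beta,t\rangle}$ are understood in the completion of the group algebra with respect to $\Lambda_+$, with coefficients meromorphic functions of $\lambda$; $[q^\beta]$ denotes the coefficient of $q^\beta$ (taken entrywise for matrices). $N_\beta\in\mathbb Z$ is the genus zero BPS multiplicity of $\beta$, and $$\Phi_\beta(\lambda,t)=\sum_{k\ge1}\frac{q^{k\beta}}{k(2\sin(k\lambda/2))^2}.$$ For $\eta\in\Lambda^\vee$ and $h=\lambda/(2\pi)$, the half step translations $T_{\pm h\eta/2}$ act coefficientwise by $T_{\pm h\eta/2}q^\beta=e^{\pm i\lambda\langle\beta,\eta\rangle/2}q^\beta$, and $\nabla_\eta=T_{h\eta/2}-T_{-h\eta/2}$. For $m\in\mathbb Z$, $[m]_u=\frac{u^m-u^{-m}}{u-u^{-1}}$ is the signed $q$-integer, viewed as a Laurent polynomial in $u$ (so $[m]_1=m$). The matrix $A_u$ has entry $[a_{ji}]_u$ in row $j$, column $i$. The coefficients of $\mathbf H$ are Laurent polynomials in $u=e^{i\lambda/2}$; identities between them are identities of Laurent polynomials (or of their ratios), not of numerical specializations. $\mathbf H^{\rm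 cl}=\mathbf H|_{\lambda=0}$ is obtained by evaluating the coefficients at $u=1$. *)

(* Defs.v *)
From HB Require Import structures.
From mathcomp Require Import all_boot all_order all_algebra.
From mathcomp Require Import fraction complex.
From mathcomp Require Import boolp classical_sets fsbigop reals sequences exp trigo.

Set Implicit Arguments.
Unset Strict Implicit.
Unset Printing Implicit Defensive.

Import Order.TTheory GRing.Theory Num.Theory.

Local Open Scope ring_scope.

(** [coroot al] is the linear form [<-, al^vee>] on [V]; only its values for
    [al] a root matter, and there they are uniquely determined. *)
Record root_system (R : realType) (V : vectType R) := RootSystem {
  roots : seq V;
  coroot : V -> 'Hom(V, R^o);
  roots_span : <<roots>>%VS = fullv;
  roots_neq0 : 0 \notin roots;
  coroot_self : forall al, al \in roots -> coroot al al = 2;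
  coroot_reflection : forall al be, al \in roots -> be \in roots ->
    be - coroot al be *: al \in roots;
  coroot_int : forall al be, al \in roots -> be \in roots ->
    coroot al be \is a Num.int }.

Definition reduced (R : realType) (V : vectType R) (Phi : root_system V) :=
  forall (al : V) (c : R), al \in roots Phi -> c *: al \in roots Phi ->
    c = 1 \/ c = -1.

(** The root lattice [Lambda] is ['rV[int]_r], in the coordinates given by the
    simple roots. *)
Definition in_space (R : realType) (V : vectType R) (r : nat)
    (Delta : r.-tuple V) (be : 'rV[int]_r) : V :=
  \sum_(j < r) tnth Delta j *~ be 0 j.

Definition effective (r : nat) (be : 'rV[int]_r) := forall j, 0 <= be 0 j.

Definition simple_system (R : realType) (V : vectType R)
    (Phi : root_system V) (r : nat) (Delta : r.-tuple V) :=
  [/\ basis_of fullv Delta,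
      {subset Delta <= roots Phi}
    & forall v, v \in roots Phi -> exists be : 'rV[int]_r,
        v = in_space Delta be /\ (effective be \/ effective (- be))].

Definition simple_root (r : nat) (j : 'I_r) : 'rV[int]_r := delta_mx 0 j.

Definition positive_roots (R : realType) (V : vectType R)
    (Phi : root_system V) (r : nat) (Delta : r.-tuple V) : set 'rV[int]_r :=
  [set be | effective be /\ in_space Delta be \in roots Phi].

(** [a_ij = <alpha_i, alpha_j^vee>]; the floor only transports this integral
    real number to [int]. *)
Definition cartan (R : realType) (V : vectType R)
    (Phi : root_system V) (r : nat) (Delta : r.-tuple V) : 'M[int]_r :=
  \matrix_(i, j) Num.floor (coroot Phi (tnth Delta j) (tnth Delta i)).

Definition simple_coroot_fun (r : nat) (A : 'M[int]_r) (i : 'I_r)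
    (be : 'rV[int]_r) : int := \sum_(j < r) be 0 j * A j i.

Lemma simple_coroot_fun_is_additive (r : nat) (A : 'M[int]_r) (i : 'I_r) :
  zmod_morphism (simple_coroot_fun A i).
Proof.
move=> x y; rewrite /simple_coroot_fun -sumrB.
by apply: eq_bigr => j _; rewrite !mxE mulrBl.
Qed.

HB.instance Definition _ (r : nat) (A : 'M[int]_r) (i : 'I_r) :=
  GRing.isZmodMorphism.Build 'rV[int]_r int (simple_coroot_fun A i)
    (simple_coroot_fun_is_additive A i).

(** The simple coroot [alpha_i^vee] as an element of [Hom(Lambda, Z)]: the
    form whose value on the simple root [alpha_j] is [a_ji]. *)
Definition simple_coroot (R : realType) (V : vectType R)
    (Phi : root_system V) (r : nat) (Delta : r.-tuple V) (i : 'I_r) :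
    {additive 'rV[int]_r -> int} :=
  simple_coroot_fun (cartan Phi Delta) i.

Definition cexp (R : realType) (z : R[i]) : R[i] :=
  (expR (complex.Re z))%:C%C * (cos (complex.Im z) +i* sin (complex.Im z))%C.

Definition csin (R : realType) (z : R[i]) : R[i] :=
  (cexp ('i%C * z) - cexp (- ('i%C * z))) / (2 * 'i%C).

(** A series is given by its coefficients: [f be lam] is [[q^be] f] at [lam].
    Meromorphic functions are total functions whose values at poles are
    arbitrary; they are compared with [mero_eq], i.e. off a closed discrete
    set.  All the series below are supported on effective classes. *)
Definition novikov_series (R : realType) (r : nat) : Type :=
  'rV[int]_r -> R[i] -> R[i].

Definition mero_eq (R : realType) (f g : R[i] -> R[i]) :=
  forall z0 : R[i], exists2 e : R[i], 0 < e &
    forall z, 0 < `|z - z0| < e -> f z = g z.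

(** [Phi_be]: the sum defining the coefficient of [q^ga] has at most one term
    as soon as [be != 0]. *)
Definition bps_series (R : realType) (r : nat) (be : 'rV[int]_r) :
    novikov_series R r := fun ga lam =>
  \sum_(k \in [set k : nat | (0 < k)%N /\ be *+ k = ga]%classic)
    (k%:R * (2 * csin (k%:R * lam / 2)) ^+ 2)^-1.

Definition bps_potential (R : realType) (V : vectType R)
    (Phi : root_system V) (r : nat) (Delta : r.-tuple V)
    (N : 'rV[int]_r -> int) : novikov_series R r := fun ga lam =>
  \sum_(be \in positive_roots Phi Delta) (N be)%:~R * bps_series be ga lam.

(** [half_step 1 eta] and [half_step (-1) eta] are [T_{h eta/2}] and
    [T_{-h eta/2}]. *)
Definition half_step (R : realType) (r : nat) (s : int)
    (eta : {additive 'rV[int]_r -> int}) (f : novikov_series R r) : novikov_series R r :=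
  fun be lam => cexp (s%:~R * ('i%C * lam * (eta be)%:~R / 2)) * f be lam.

Definition nabla (R : realType) (r : nat)
    (eta : {additive 'rV[int]_r -> int}) (f : novikov_series R r) : novikov_series R r :=
  fun be lam => half_step 1 eta f be lam - half_step (-1) eta f be lam.

Definition hessian (R : realType) (V : vectType R)
    (Phi : root_system V) (r : nat) (Delta : r.-tuple V)
    (N : 'rV[int]_r -> int) (a b : 'I_r) : novikov_series R r :=
  nabla (simple_coroot Phi Delta a)
    (nabla (simple_coroot Phi Delta b) (bps_potential Phi Delta N)).

Definition ratfun (R : realType) := {fraction {poly R[i]}}.

Definition uvar (R : realType) : ratfun R := tofrac ('X : {poly R[i]}).

Definition laurent_repr (R : realType) (x : ratfun R) (p : {poly R[i]})
    (n : nat) := x = tofrac p / uvar R ^+ n.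

Definition is_laurent (R : realType) (x : ratfun R) :=
  exists p n, laurent_repr x p n.

(** Value of a Laurent polynomial at [z]; for [z != 0] it does not depend on
    the representation of [x]. *)
Definition laurent_eval (R : realType) (x : ratfun R) (z : R[i]) : R[i] :=
  xget 0 [set c | exists p n, laurent_repr x p n /\ c = p.[z] / z ^+ n]%classic.

(** The function [f] of [lambda] is the Laurent polynomial [x] in
    [u = e^{i lambda/2}]. *)
Definition is_laurent_of (R : realType) (f : R[i] -> R[i]) (x : ratfun R) :=
  is_laurent x /\
  mero_eq f (fun lam => laurent_eval x (cexp ('i%C * lam / 2))).

(** The Laurent polynomial in [u = e^{i lambda/2}] equal to [f]; it is unique,
    since [lambda |-> u] takes infinitely many values near any point. *)
Definition laurent_of (R : realType) (f : R[i] -> R[i]) : ratfun R :=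
  xget 0 [set x | is_laurent_of f x]%classic.

Definition qint (R : realType) (m : int) : ratfun R :=
  (uvar R ^ m - uvar R ^ (- m)) / (uvar R - (uvar R)^-1).

(** [[q^be] H], entrywise, as a matrix of Laurent polynomials. *)
Definition hessian_coef (R : realType) (V : vectType R)
    (Phi : root_system V) (r : nat) (Delta : r.-tuple V)
    (N : 'rV[int]_r -> int) (be : 'rV[int]_r) : 'M[ratfun R]_r :=
  \matrix_(a, b) laurent_of (hessian Phi Delta N a b be).

(** [lambda = 0] is [u = 1]. *)
Definition hessian_cl_coef (R : realType) (V : vectType R)
    (Phi : root_system V) (r : nat) (Delta : r.-tuple V)
    (N : 'rV[int]_r -> int) (be : 'rV[int]_r) : 'M[R[i]]_r :=
  map_mx (fun x => laurent_eval x 1) (hessian_coef Phi Delta N be).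

Definition qcartan (R : realType) (r : nat) (A : 'M[int]_r) : 'M[ratfun R]_r :=
  \matrix_(j, i) qint R (A j i).

Definition qcartan_col (R : realType) (r : nat) (A : 'M[int]_r) (j : 'I_r) :
    'cV[ratfun R]_r :=
  \col_i qint R (A j i).

Definition bps_diag (R : realType) (r : nat) (N : 'rV[int]_r -> int) :
    'M[ratfun R]_r :=
  diag_mx (\row_j (N (simple_root j))%:~R).

Definition gram (R : realType) (V : vectType R)
    (Phi : root_system V) (r : nat) (Delta : r.-tuple V)
    (N : 'rV[int]_r -> int) : 'M[ratfun R]_r :=
  - \sum_(j < r) hessian_coef Phi Delta N (simple_root j).

(* Main.v *)
Require Import Defs.
From HB Require Import structures.
From mathcomp Require Import all_boot all_order all_algebra.
From mathcomp Require Import fraction complex.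
From mathcomp Require Import boolp classical_sets fsbigop reals sequences exp trigo.
From mathcomp Require Import ring.

Set Implicit Arguments.
Unset Strict Implicit.
Unset Printing Implicit Defensive.

Import Order.TTheory GRing.Theory Num.Theory.

Local Open Scope ring_scope.

(** A simple root is indivisible in the root lattice, so among all classes [be]
    and all multiplicities [k] the only term of the potential in degree
    [q^(alpha_j)] is [be = alpha_j], [k = 1].  It equals
    [N_(alpha_j) / (2 sin (lambda/2))^2], where, with [u = e^(i lambda/2)],
    [(2 sin (lambda/2))^2 = - (u - u^-1)^2].  On that coefficient the difference
    operator along the coroot [alpha_a^vee] is multiplication by
    [u^(a_ja) - u^(- a_ja)], so two of them, divided by [- (u - u^-1)^2], give
    [- N_(alpha_j) [a_ja]_u [a_jb]_u] ([hessian_laurent]): the double pole of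
    the multiple cover term is cancelled exactly by the two differences.
    Everything else is linear algebra on these rank one matrices: ratios of
    entries isolate the Cartan integers because [a_jj = 2], and summing over [j]
    assembles the factorization [A_u^T D_N A_u].

    The analytic work is in passing between functions of [lambda] and Laurent
    polynomials in [u].  The coefficient formula fails only where [u^2 = 1],
    and these points are isolated ([cexp_neq1_isolated]) because [e^(iz)] takes
    the value 1 only at [z = 0] in the unit disc.  The same fact makes [u]
    injective on a short real segment, so two Laurent polynomials that agree as
    functions of [lambda] near one point agree at infinitely many [u] and are
    equal ([laurent_of_unique]); hence the coefficient is that Laurent
    polynomial and no other. *)

(** * The complex exponential *)

Lemma cexpD (R : realType) (z w : R[i]) : cexp (z + w) = cexp z * cexp w.
Proof.
case: z w => [a b] [c d]; rewrite /cexp /= expRD cosD sinD.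
by apply/eqP; rewrite eq_complex /=; apply/andP; split; apply/eqP; ring.
Qed.

Lemma cexp0 (R : realType) : cexp 0 = 1 :> R[i].
Proof. by rewrite /cexp /= expR0 cos0 sin0 mul1r. Qed.

Lemma cexpN (R : realType) (z : R[i]) : cexp (- z) = (cexp z)^-1.
Proof. by apply/esym/mulr1_eq; rewrite -cexpD subrr cexp0. Qed.

Lemma cexp_neq0 (R : realType) (z : R[i]) : cexp z != 0.
Proof.
rewrite -unitfE; apply/unitrPr; exists (cexp (- z)).
by rewrite -cexpD subrr cexp0.
Qed.

Lemma cexpMint (R : realType) (m : int) (z : R[i]) :
  cexp (m%:~R * z) = cexp z ^ m.
Proof.
have nat_case n : cexp (n%:R * z) = cexp z ^+ n.
  elim: n => [|n IH]; first by rewrite mul0r cexp0 expr0.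
  by rewrite exprS -IH -cexpD -[n.+1]add1n natrD mulrDl mul1r.
case: (intP m) => [|n|n]; first by rewrite mul0r cexp0 expr0z.
  by rewrite -[n.+1%:~R]/(n.+1%:R) nat_case.
by rewrite mulrNz mulNr cexpN -[n.+1%:~R]/(n.+1%:R) nat_case exprnN.
Qed.

(** For [z = a + ib] the number [e^(iz)] has imaginary part [e^(-b) sin a],
    which vanishes only for [a = 0] since [1 < pi]; its modulus [e^(-b)] then
    forces [b = 0]. *)
Lemma cexp_eq1_near0 (R : realType) (z : R[i]) :
  cexp ('i%C * z) = 1 -> `|z| < 1 -> z = 0.
Proof.
case: z => a b + z_lt1.
have a_lt1 : `|a| < 1.
  by have := le_lt_trans (normc_ge_Re (a +i* b)%C) z_lt1; rewrite /= ltcR.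
rewrite /cexp /= !(mul0r, mul1r, add0r, addr0, sub0r) => -[].
rewrite !(mul0r, subr0, addr0) => exp_cos /eqP.
rewrite mulf_eq0 gt_eqF ?expR_gt0 //= => /eqP sin_a0.
have a0 : a = 0.
  have pos (x : R) : 0 < x -> `|x| < 1 -> sin x != 0.
    move=> x0 x1; rewrite gt_eqF ?sin_gt0_pi // x0 /=.
    rewrite gtr0_norm // in x1.
    by rewrite (lt_trans x1) // (lt_le_trans _ (pi_ge2 R)) // ltr1n.
  apply/eqP/negPn/negP => /lt_total /orP[a_lt0|a_gt0].
    have := pos (- a); rewrite oppr_gt0 normrN sinN sin_a0 oppr0 eqxx.
    by move=> /(_ a_lt0 a_lt1).
  by have := pos a a_gt0 a_lt1; rewrite sin_a0 eqxx.
move: exp_cos; rewrite a0 cos0 mulr1 -expR0 => /expR_inj /eqP.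
by rewrite oppr_eq0 => /eqP ->.
Qed.

(** Two solutions of [e^(iz) = 1] differ by a solution, so they are at distance
    at least 1: a disc of radius 1/2 around [z0] contains at most one of them.
    The punctured disc is shrunk to avoid it when it is not [z0] itself. *)
Lemma cexp_neq1_isolated (R : realType) (z0 : R[i]) :
  exists2 e : R[i], 0 < e &
    forall z, 0 < `|z - z0| < e -> cexp ('i%C * z) != 1.
Proof.
have half_gt0 : 0 < 2^-1 :> R[i] by rewrite invr_gt0 ltr0n.
have [[z1 [z1_neq z1_near z1_eq1]]|none] := pselect (exists z1 : R[i],
    [/\ z1 != z0, `|z1 - z0| < 2^-1 & cexp ('i%C * z1) = 1]); last first.
  exists 2^-1 => // z /andP[z_neq z_near]; apply/eqP => z_eq1.
  by apply: none; exists z; split; rewrite // -subr_eq0 -normr_gt0.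
exists `|z1 - z0|; first by rewrite normr_gt0 subr_eq0.
move=> z /andP[_ z_near]; apply/eqP => z_eq1.
have : z - z1 = 0.
  apply: cexp_eq1_near0.
    by rewrite mulrBr cexpD cexpN z_eq1 z1_eq1 invr1 mulr1.
  have -> : z - z1 = (z - z0) - (z1 - z0) by ring.
  apply: le_lt_trans (ler_normB _ _) _.
  by rewrite [1]splitr mul1r ltrD // (lt_trans z_near).
by move=> /eqP; rewrite subr_eq0 => /eqP z_z1; move: z_near; rewrite z_z1 ltxx.
Qed.

(** * Laurent polynomials and their values *)

Lemma uvar_neq0 (R : realType) : uvar R != 0.
Proof. by rewrite tofrac_eq0 polyX_eq0. Qed.

Lemma laurent_repr_eval_unique (R : realType) (x : ratfun R) p n q m (z : R[i]) :
  z != 0 -> laurent_repr x p n -> laurent_repr x q m ->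
  p.[z] / z ^+ n = q.[z] / z ^+ m.
Proof.
move=> z0 xp; rewrite /laurent_repr xp => /eqP.
rewrite eqr_div ?expf_neq0 ?uvar_neq0 // -!tofracXn -!tofracM tofrac_eq.
move=> /eqP /(congr1 (horner^~ z)); rewrite !(hornerM, hornerXn) => pq.
by apply/eqP; rewrite eqr_div ?expf_neq0 // pq.
Qed.

Lemma laurent_evalE (R : realType) (x : ratfun R) p n (z : R[i]) :
  z != 0 -> laurent_repr x p n -> laurent_eval x z = p.[z] / z ^+ n.
Proof.
move=> z0 xp; rewrite /laurent_eval.
have [|q [m [xq ->]]] := @xgetPex _ 0 [set c | exists p n,
  laurent_repr x p n /\ c = p.[z] / z ^+ n]%classic.
  by exists (p.[z] / z ^+ n), p, n.
exact: laurent_repr_eval_unique xq xp.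
Qed.

Lemma laurent_reprM (R : realType) (x y : ratfun R) p n q m :
  laurent_repr x p n -> laurent_repr y q m ->
  laurent_repr (x * y) (p * q) (n + m).
Proof. by move=> -> ->; rewrite /laurent_repr tofracM exprD mulf_div. Qed.

Lemma is_laurentM (R : realType) (x y : ratfun R) :
  is_laurent x -> is_laurent y -> is_laurent (x * y).
Proof.
move=> [p [n xp]] [q [m yq]]; exists (p * q), (n + m)%N.
exact: laurent_reprM.
Qed.

Lemma laurent_evalM (R : realType) (x y : ratfun R) (z : R[i]) :
  z != 0 -> is_laurent x -> is_laurent y ->
  laurent_eval (x * y) z = laurent_eval x z * laurent_eval y z.
Proof.
move=> z0 [p [n xp]] [q [m yq]].
rewrite (laurent_evalE z0 (laurent_reprM xp yq)).
by rewrite (laurent_evalE z0 xp) (laurent_evalE z0 yq) hornerM exprD mulf_div.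
Qed.

Lemma laurent_repr_int (R : realType) (k : int) :
  laurent_repr (k%:~R : ratfun R) (k%:~R) 0.
Proof. by rewrite /laurent_repr rmorph_int divr1. Qed.

Lemma is_laurent_int (R : realType) (k : int) : is_laurent (k%:~R : ratfun R).
Proof. by exists k%:~R, 0%N; exact: laurent_repr_int. Qed.

Lemma laurent_eval_int (R : realType) (k : int) (z : R[i]) :
  z != 0 -> laurent_eval (k%:~R : ratfun R) z = k%:~R.
Proof.
move=> z0; rewrite (laurent_evalE z0 (laurent_repr_int R k)) divr1.
by rewrite -(rmorph_int (@polyC R[i])) hornerC.
Qed.

(** * Quantum integers as Laurent polynomials *)

Lemma qintN (R : realType) (m : int) : qint R (- m) = - qint R m.
Proof. by rewrite /qint opprK -mulNr opprB. Qed.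

(** The quotient defining [[m]_v] is a geometric sum in [v^2].  Over an arbitrary
    field it serves both for the formal variable [u], where it shows that
    [[m]_u] is a Laurent polynomial, and for its values at complex numbers.
    The numerator is kept as a sum times [v] over [v^m] rather than [v^(m-1)],
    so that no predecessor appears when [m = 0]. *)
Lemma geometric_qint (F : fieldType) (v : F) (m : nat) :
  v != 0 -> v ^+ 2 != 1 ->
  (\sum_(k < m) (v ^+ 2) ^+ k) * v / v ^+ m =
  (v ^ m%:Z - v ^ (- m%:Z)) / (v - v^-1).
Proof.
move=> v0 v2; have vm : v ^+ m != 0 by rewrite expf_neq0.
have v21 : v ^+ 2 - 1 != 0 by rewrite subr_eq0.
have -> : \sum_(k < m) (v ^+ 2) ^+ k = (v ^+ m * v ^+ m - 1) / (v ^+ 2 - 1).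
  by rewrite -exprMn -expr2 subrX1 mulrAC mulfV // mul1r.
rewrite -exprnN -exprnP; field.
by rewrite vm v0 -expr2 v21.
Qed.

Lemma laurent_repr_qint_nat (R : realType) (m : nat) :
  laurent_repr (qint R m) ((\sum_(k < m) ('X ^+ 2) ^+ k) * 'X) m.
Proof.
have u2 : uvar R ^+ 2 != 1.
  rewrite -tofracXn -tofrac1 tofrac_eq.
  by apply/eqP => /(congr1 (size \o polyseq)) /=; rewrite size_polyXn size_poly1.
rewrite /laurent_repr /qint -(geometric_qint _ (uvar_neq0 R) u2).
rewrite tofracM rmorph_sum /=; congr (_ * _ / _).
by apply: eq_bigr => k _; rewrite !tofracXn.
Qed.

Lemma is_laurent_qint (R : realType) (m : int) : is_laurent (qint R m).
Proof.
case: m => n; first by do 2 eexists; exact: laurent_repr_qint_nat.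
rewrite NegzE qintN -mulN1r -[-1]/((- 1)%:~R).
apply: is_laurentM; first exact: is_laurent_int.
by do 2 eexists; exact: laurent_repr_qint_nat.
Qed.

Lemma laurent_eval_qint_opp (R : realType) (m : int) (z : R[i]) : z != 0 ->
  laurent_eval (qint R (- m)) z = - laurent_eval (qint R m) z.
Proof.
move=> z0; rewrite qintN -mulN1r -[-1]/((- 1)%:~R).
rewrite laurent_evalM ?laurent_eval_int ?mulN1r //.
  exact: is_laurent_int.
exact: is_laurent_qint.
Qed.

Lemma laurent_eval_qint_nat (R : realType) (m : nat) (z : R[i]) : z != 0 ->
  laurent_eval (qint R m) z = (\sum_(k < m) (z ^+ 2) ^+ k) * z / z ^+ m.
Proof.
move=> z0; rewrite (laurent_evalE z0 (laurent_repr_qint_nat R m)).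
rewrite hornerM hornerX horner_sum; congr (_ * _ / _).
by apply: eq_bigr => k _; rewrite !horner_exp hornerX.
Qed.

Lemma laurent_eval_qint (R : realType) (m : int) (z : R[i]) :
  z != 0 -> z ^+ 2 != 1 ->
  laurent_eval (qint R m) z = (z ^ m - z ^ (- m)) / (z - z^-1).
Proof.
move=> z0 z2; case: m => n.
  by rewrite laurent_eval_qint_nat // geometric_qint.
rewrite NegzE laurent_eval_qint_opp // laurent_eval_qint_nat // geometric_qint //.
by rewrite opprK -mulNr opprB.
Qed.

(** At [u = 1] the quotient is 0/0; the geometric sum has [m] terms equal to
    1. *)
Lemma laurent_eval_qint1 (R : realType) (m : int) :
  laurent_eval (qint R m) 1 = m%:~R.
Proof.
have nat_case n : laurent_eval (qint R n%:Z) 1 = n%:R.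
  rewrite laurent_eval_qint_nat ?oner_neq0 // !expr1n mulr1 divr1.
  under eq_bigr do rewrite expr1n.
  by rewrite sumr_const card_ord.
case: m => n; first exact: nat_case.
by rewrite NegzE laurent_eval_qint_opp ?oner_neq0 // nat_case mulrNz.
Qed.

Lemma qint2_neq0 (R : realType) : qint R 2 != 0.
Proof.
apply/eqP => /(congr1 (fun x => laurent_eval x 1)).
rewrite laurent_eval_qint1 -[0 : ratfun R]/(0%:~R).
by rewrite laurent_eval_int ?oner_neq0 // => /eqP; rewrite eqr_int.
Qed.

(** * Laurent polynomials are determined by their functions of lambda *)

(** On a common denominator the difference of two candidates has numerator [d],
    a polynomial that vanishes at [u = e^(i lambda/2)] for all small
    [lambda != 0].  The real points [lambda_k = t/(k+2)] give more distinct
    values of [u] than [d] can have roots: [u_k = u_l] means that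
    [e^(i (lambda_k - lambda_l)/2) = 1] with a small argument. *)
Lemma laurent_of_unique (R : realType) (f : R[i] -> R[i]) (x y : ratfun R) :
  is_laurent_of f x -> is_laurent_of f y -> x = y.
Proof.
move=> [[p [n xp]] fx] [[q [m yq]] fy].
have [e1 e1_gt0 {}fx] := fx 0; have [e2 e2_gt0 {}fy] := fy 0.
have u0 := uvar_neq0 R.
rewrite xp yq; apply/eqP; rewrite eqr_div ?expf_neq0 // -!tofracXn -!tofracM.
rewrite tofrac_eq -subr_eq0; set d := _ - _.
apply/negPn/negP => d_neq0.
(* A radius in which both identities hold; dividing it by [k + 2] rather than
   [k + 1] keeps the points strictly inside. *)
pose t := Num.min (Num.min (complex.Re e1) (complex.Re e2)) 1.
pose lam (k : nat) : R[i] := (t / k.+2%:R)%:C%C.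
have [e1E e2E] : e1 = (complex.Re e1)%:C%C /\ e2 = (complex.Re e2)%:C%C.
  by split; rewrite RRe_real // gtr0_real.
have t_gt0 : 0 < t.
  by move: e1_gt0 e2_gt0; rewrite e1E e2E !ltcR !lt_min ltr01 => -> ->.
have lam_gt0 k : 0 < lam k by rewrite ltcR divr_gt0.
have lam_lt k : lam k < t%:C%C.
  by rewrite ltcR gtr_pMr // invf_lt1 // ltr1n.
have lam_e1 k : lam k < e1.
  apply: lt_le_trans (lam_lt k) _; rewrite e1E lecR.
  by rewrite !ge_min lexx.
have lam_e2 k : lam k < e2.
  apply: lt_le_trans (lam_lt k) _; rewrite e2E lecR.
  by rewrite !ge_min lexx orbT.
have lam_lt1 k : lam k < 1.
  apply: lt_le_trans (lam_lt k) _; rewrite -[1]/(1%:C%C) lecR.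
  by rewrite ge_min lexx orbT.
pose u k := cexp ('i%C * lam k / 2).
have u_inj : injective u.
  move=> k l ukl; have /eqP : (lam k - lam l) / 2 = 0.
    apply: cexp_eq1_near0.
      rewrite mulrA mulrBr mulrBl cexpD cexpN -/(u k) -/(u l) ukl.
      by rewrite divff ?cexp_neq0.
    rewrite normrM normfV normr_nat ltr_pdivrMr ?ltr0n // mul1r.
    rewrite (le_lt_trans (ler_normB _ _)) // !gtr0_norm //.
    by rewrite -[2]/(1 + 1) ltrD.
  rewrite mulf_eq0 invr_eq0 pnatr_eq0 orbF subr_eq0 => /eqP [].
  move=> /(mulfI (lt0r_neq0 t_gt0)) /invr_inj /eqP.
  by rewrite eqr_nat !eqSS => /eqP.
have u_root k : root d (u k).
  have uk0 : u k != 0 := cexp_neq0 _.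
  have near0 e : lam k < e -> 0 < `|lam k - 0| < e.
    by rewrite subr0 gtr0_norm // lam_gt0.
  have := fx _ (near0 _ (lam_e1 k)); rewrite (fy _ (near0 _ (lam_e2 k))).
  rewrite -/(u k) (laurent_evalE uk0 xp) (laurent_evalE uk0 yq).
  move=> /eqP; rewrite eqr_div ?expf_neq0 // => /eqP pq.
  by rewrite /root /d hornerD hornerN !hornerM !hornerXn pq subrr.
have all_u : all (root d) [seq u k | k <- iota 0 (size d)].
  by apply/allP => _ /mapP[k _ ->].
have := max_poly_roots d_neq0 all_u.
by rewrite size_map size_iota ltnn map_inj_uniq // iota_uniq => /(_ isT).
Qed.

Lemma laurent_of_eq (R : realType) (f : R[i] -> R[i]) (x : ratfun R) :
  is_laurent_of f x -> laurent_of f = x.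
Proof.
by move=> fx; apply: laurent_of_unique (fx); apply: xgetPex; exists x.
Qed.

(** * The Hessian coefficient of a simple root *)

Lemma simple_root_indivisible (r : nat) (j : 'I_r) (be : 'rV[int]_r) (k : nat) :
  be *+ k = simple_root j -> k = 1%N /\ be = simple_root j.
Proof.
move=> bek; suff k1 : k = 1%N by split; rewrite // -bek k1.
have : (k %| 1)%N.
  have /(congr1 absz) : be 0 j *+ k = 1.
    by rewrite -mulmxnE bek mxE !eqxx.
  by rewrite -mulr_natr abszM => /= <-; rewrite natz dvdn_mull.
by rewrite dvdn1 => /eqP.
Qed.

Lemma bps_series_simple_root (R : realType) (r : nat) (j : 'I_r)
    (be : 'rV[int]_r) (lam : R[i]) :
  bps_series be (simple_root j) lam =
  if be == simple_root j then (2 * csin (lam / 2)) ^- 2 else 0.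
Proof.
rewrite /bps_series; case: eqP => [->|be_neq].
  rewrite (_ : [set k | _]%classic = [set 1%N]%classic).
    by rewrite fsbig_set1 !mul1r.
  apply/seteqP; split => k /=; first by case=> _ /simple_root_indivisible[].
  by move=> ->.
rewrite (_ : [set k | _]%classic = set0) ?fsbig_set0 //.
by apply/seteqP; split => k //= -[_ /simple_root_indivisible[_ /be_neq]].
Qed.

Lemma in_space_simple_root (R : realType) (V : vectType R) (r : nat)
    (Delta : r.-tuple V) (j : 'I_r) :
  in_space Delta (simple_root j) = tnth Delta j.
Proof.
rewrite /in_space (bigD1 j) //= big1 => [|k k_neq]; rewrite mxE eqxx ?eqxx /=.
  by rewrite addr0.
by rewrite (negPf k_neq).
Qed.

Lemma bps_potential_simple_root (R : realType) (V : vectType R)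
    (Phi : root_system V) (r : nat) (Delta : r.-tuple V)
    (N : 'rV[int]_r -> int) (j : 'I_r) (lam : R[i]) :
  {subset Delta <= Defs.roots Phi} ->
  bps_potential Phi Delta N (simple_root j) lam =
  (N (simple_root j))%:~R / (2 * csin (lam / 2)) ^+ 2.
Proof.
move=> Delta_roots; rewrite /bps_potential.
rewrite -(fsbig_widen [set simple_root j]%classic); last 2 first.
- move=> _ ->; split=> /=; first by move=> k; rewrite mxE; case: (_ && _).
  by rewrite in_space_simple_root Delta_roots ?mem_tnth.
- move=> be [_ /= be_neq]; rewrite bps_series_simple_root ifN ?mulr0 //.
  exact/eqP.
by rewrite fsbig_set1 bps_series_simple_root eqxx.
Qed.

(** Both half steps are diagonal on monomials; their difference multiplies the
    coefficient of [q^be] by [u^<be,eta> - u^(-<be,eta>)]. *)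
Lemma nablaE (R : realType) (r : nat) (eta : {additive 'rV[int]_r -> int})
    (f : novikov_series R r) (be : 'rV[int]_r) (lam : R[i]) :
  let u := cexp ('i%C * lam / 2) in
  nabla eta f be lam = (u ^ eta be - u ^ (- eta be)) * f be lam.
Proof.
rewrite /nabla /half_step mulrBl -!cexpMint mulr1z mul1r mulrNz mulN1r.
by congr (cexp _ * _ - cexp _ * _); rewrite -?mulNr; ring.
Qed.

Lemma simple_coroot_simple_root (R : realType) (V : vectType R)
    (Phi : root_system V) (r : nat) (Delta : r.-tuple V) (i j : 'I_r) :
  simple_coroot Phi Delta i (simple_root j) = cartan Phi Delta j i.
Proof.
rewrite /simple_coroot /= /simple_coroot_fun (bigD1 j) //= big1 => [|k k_neq].
  by rewrite addr0 mxE !eqxx mul1r.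
by rewrite mxE (negPf k_neq) andbF mul0r.
Qed.

(** The identity holds wherever [u^2 != 1].  At the remaining isolated points the
    left side is 0 by the convention on inverses of 0 while the right side need
    not vanish, so it is only an equality of meromorphic functions. *)
Lemma hessian_laurent (R : realType) (V : vectType R)
    (Phi : root_system V) (r : nat) (Delta : r.-tuple V)
    (N : 'rV[int]_r -> int) (j a b : 'I_r) :
  {subset Delta <= Defs.roots Phi} ->
  let A := cartan Phi Delta in
  is_laurent_of (hessian Phi Delta N a b (simple_root j))
    ((- N (simple_root j))%:~R * (qint R (A j a) * qint R (A j b))).
Proof.
move=> Delta_roots A; set m := N _.
have lN : is_laurent ((- m)%:~R : ratfun R) := is_laurent_int R _.
have lq k : is_laurent (qint R k) := is_laurent_qint R k.
split; first by do 2 apply: is_laurentM => //.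
move=> z0; have [e e_gt0 eP] := cexp_neq1_isolated z0.
exists e => // lam /eP u2.
have u_eq : cexp ('i%C * (lam / 2)) = cexp ('i%C * lam / 2) by rewrite mulrA.
have lamE : 'i%C * lam = 2%:~R * ('i%C * lam / 2) by field.
rewrite lamE cexpMint in u2.
rewrite /hessian !nablaE !simple_coroot_simple_root -/A.
rewrite bps_potential_simple_root // /csin cexpN u_eq.
have := cexp_neq0 ('i%C * lam / 2); move: u2.
move: (cexp _) => u u2 u0.
rewrite (laurent_evalM u0 lN) ?(laurent_evalM u0 (lq _) (lq _)); last first.
  exact: is_laurentM.
rewrite laurent_eval_int // !laurent_eval_qint // mulrNz -/m.
have usub : u ^+ 2 - 1 != 0 by rewrite subr_eq0.
have w0 : u - u^-1 != 0.
  rewrite (_ : _ - _ = (u ^+ 2 - 1) / u) ?mulf_neq0 ?invr_eq0 //.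
  by field.
move: (u - u^-1) w0 => w w0.
(* [2 sin (lambda/2) = (u - u^-1) / i]. *)
have -> : (2 * (w / (2 * 'i%C))) ^+ 2 = - w ^+ 2.
  rewrite invfM mulrCA mulVKf ?pnatr_eq0 // exprMn exprVn sqr_i.
  by rewrite invrN1 mulrN1.
move: (u ^ _ - _) (u ^ _ - _) (m%:~R : R[i]) => x y n.
by field.
Qed.

Lemma cartan_diag (R : realType) (V : vectType R)
    (Phi : root_system V) (r : nat) (Delta : r.-tuple V) (j : 'I_r) :
  {subset Delta <= Defs.roots Phi} -> cartan Phi Delta j j = 2.
Proof.
move=> Delta_roots; rewrite mxE coroot_self ?Delta_roots ?mem_tnth //.
exact: (intrKfloor 2).
Qed.

(** * The Cartan matrix from the Hessian profiles *)

Theorem theorem1p5 (R : realType) (V : vectType R) (Phi : root_system V)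
    (r : nat) (Delta : r.-tuple V) (N : 'rV[int]_r -> int)
    (hred : reduced Phi) (hsimple : simple_system Phi Delta) :
  let A := cartan Phi Delta in
  let A_u := qcartan R A in
  let c := qcartan_col R A in
  let D_N := bps_diag R N in
  let G := gram Phi Delta N in
  let P := fun j : 'I_r => - hessian_coef Phi Delta N (simple_root j) in
  let Pcl := fun j : 'I_r => - hessian_cl_coef Phi Delta N (simple_root j) in
  [/\ forall j a b : 'I_r,
        is_laurent_of (hessian Phi Delta N a b (simple_root j))
          (hessian_coef Phi Delta N (simple_root j) a b),
      forall j : 'I_r, P j = (N (simple_root j))%:~R *: (c j *m (c j)^T),
      (forall j : 'I_r, N (simple_root j) != 0) ->
        forall i j : 'I_r,
          [/\ P j j j != 0,
              P j i j / P j j j = qint R (A j i) / qint R 2,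
              Pcl j j j != 0
            & (A j i)%:~R = 2 * (Pcl j i j / Pcl j j j)],
      G = A_u^T *m D_N *m A_u
    & \det G = (\prod_(j < r) (N (simple_root j))%:~R) * \det A_u ^+ 2].
Proof.
move=> A A_u c D_N G P Pcl; have [_ Delta_roots _] := hsimple.
have entry j a b : hessian_coef Phi Delta N (simple_root j) a b =
    (- N (simple_root j))%:~R * (qint R (A j a) * qint R (A j b)).
  by rewrite mxE; apply: laurent_of_eq; exact: hessian_laurent.
have PE j a b : P j a b =
    (N (simple_root j))%:~R * (qint R (A j a) * qint R (A j b)).
  by rewrite mxE entry mulrNz mulNr opprK.
have PclE j a b : Pcl j a b = (N (simple_root j) * (A j a * A j b))%:~R.
  have lq k : is_laurent (qint R k) := is_laurent_qint R k.
  have one0 : 1 != 0 :> R[i] := oner_neq0 _.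
  rewrite mxE [X in - X]mxE entry.
  rewrite (laurent_evalM one0 (is_laurent_int R _)); last exact: is_laurentM.
  rewrite (laurent_evalM one0 (lq _) (lq _)) laurent_eval_int //.
  by rewrite !laurent_eval_qint1 mulrNz mulNr opprK !rmorphM.
have A_diag j : A j j = 2 by exact: cartan_diag.
have q2 := qint2_neq0 R.
have GE : G = A_u^T *m D_N *m A_u.
  apply/matrixP => a b; rewrite mxE summxE -sumrN mxE; apply: eq_bigr => j _.
  by rewrite mul_mx_diag entry mulrNz !mxE; ring.
split; last 2 first.
- exact: GE.
- rewrite GE !det_mulmx det_tr det_diag.
  rewrite mulrC mulrA -expr2 mulrC; congr (_ * _).
  by apply: eq_bigr => j _; rewrite mxE.
- move=> j a b; rewrite entry; exact: hessian_laurent.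
- move=> j; apply/matrixP => a b; by rewrite PE !mxE big_ord1 !mxE.
- have ratio (F : fieldType) (n x y : F) :
      n != 0 -> y != 0 -> n * (x * y) / (n * (y * y)) = x / y.
    by move=> n0 y0; field; rewrite n0 y0.
  move=> N_neq0 i j; have Nj := N_neq0 j.
  have NjF : (N (simple_root j))%:~R != 0 :> ratfun R.
    rewrite -(rmorph_int (@tofrac {poly R[i]})) tofrac_eq0.
    by rewrite -(rmorph_int (@polyC R[i])) polyC_eq0 intr_eq0.
  rewrite !PE !PclE !A_diag; split.
  + exact: mulf_neq0 NjF (mulf_neq0 q2 q2).
  + exact: (ratio _ _ (qint R (A j i)) _ NjF q2).
  + by rewrite intr_eq0 !mulf_neq0.
  + by rewrite !intrM ratio ?intr_eq0 // mulrC divfK ?intr_eq0.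
Qed.
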